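(* Let $X_N \subsetneq X_M \subset X^{\mathcal{N}}$ be reduced trial spaces with $\dim(X_M) = M > N = \dim(X_N)$, and for $\mu\in\mathcal{P}$ let $u^{\mathcal{N}}(\mu)\in X^{\mathcal{N}}$ be the truth solution and $u_N(\mu)\in X_N$, $u_M(\mu)\in X_M$ the corresponding reduced basis approximations. Assume that $X_N$ and $X_M$ satisfy the saturation property, i.e. there exists a constant $\Theta_{N,M}^{\mathcal{N}}\in(0,1)$ such that $$\| u^{\mathcal{N}}(\mu) - u_{M}(\mu) \|_{X^{\mathcal{N}}} \leq \Theta_{N,M}^{\mathcal{N}} \, \| u^{\mathcal{N}}(\mu) - u_{N}(\mu) \|_{X^{\mathcal{N}}} \qquad \text{for all } \mu\in\mathcal{P}.$$ Then, with $\Delta_{N,M}(\mu) := \| u_{M}(\mu) - u_N(\mu) \|_{X^{\mathcal{N}}}$, for every $\mu\in\mathcal{P}$ it holds that $$\frac{\Delta_{N,M}(\mu)}{1+\Theta_{N,M}^{\mathcal{N}}} \le \| u^{\mathcal{N}}(\mu) - u_N(\mu) \|_{X^{\mathcal{N}}} \le \frac{\Delta_{N,M}(\mu)}{1-\Theta_{N,M}^{\mathcal{N}}}.$$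
   Context: Let $\mathcal{P}\subset\mathbb{R}^P$ ($P \in \mathbb{N}$) be a compact parameter space, and $\mathbb{K}\in\{\mathbb{R},\mathbb{C}\}$. Let $X^{\mathcal{N}}$, $Y^{\mathcal{N}}$ be finite-dimensional $\mathbb{K}$-vector spaces of equal dimension $\mathcal{N}<\infty$ (discrete trial and test spaces, conforming subspaces of Hilbert spaces $X$ and $Y$), with norms $\|\cdot\|_{X^{\mathcal{N}}}$ and $\|\cdot\|_{Y^{\mathcal{N}}}$. For each $\mu\in\mathcal{P}$ let $a^{\mathcal{N}}(\cdot,\cdot;\mu): X^{\mathcal{N}}\times Y^{\mathcal{N}}\to\mathbb{K}$ be a continuous sesquilinear form (linear in the first, antilinear in the second argument; bilinear if $\mathbb{K}=\mathbb{R}$) and $f^{\mathcal{N}}(\cdot;\mu): Y^{\mathcal{N}}\to\mathbb{K}$ a continuous antilinear form (linear if $\mathbb{K}=\mathbb{R}$). Assume there is a constant $\beta_{\mathrm{LB}}^{\mathcal{N}}>0$ such that for all $\mu\in\mathcal{P}$ $$\inf_{0\ne w\in X^{\mathcal{N}}}\sup_{0\ne v\in Y^{\mathcal{N}}}\frac{|a^{\mathcal{N}}(w,v;\mu)|}{\|w\|_{X^{\mathcal{N}}}\|v\|_{Y^{\mathcal{N}}}}\ge\beta_{\mathrm{LB}}^{\mathcal{N}}.$$ Truth solution: for $\mu\in\mathcal{P}$, $u^{\mathcal{N}}(\mu)\in X^{\mathcal{N}}$ is the unique solution of $a^{\mathcal{N}}(u^{\mathcal{N}}(\mu),v;\mu)=f^{\mathcal{N}}(v;\mu)$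 for all $v\in Y^{\mathcal{N}}$. Reduced basis approximation: $X_N=\mathrm{span}\{\xi_1,\dots,\xi_N\}\subset X^{\mathcal{N}}$ is an $N$-dimensional space spanned by snapshots $\xi_i=u^{\mathcal{N}}(\mu_i)$ for selected parameters $\mu_1,\dots,\mu_N\in\mathcal{P}$. The particular construction of the larger reduced space $X_M$ is not specified. For $K\in\{N,M\}$, $Y_K\subset Y^{\mathcal{N}}$ is a reduced test space with $\dim Y_K=\dim X_K=K$ such that for all $\mu\in\mathcal{P}$ $$\inf_{0\ne w\in X_K}\sup_{0\ne v\in Y_K}\frac{|a^{\mathcal{N}}(w,v;\mu)|}{\|w\|_{X^{\mathcal{N}}}\|v\|_{Y^{\mathcal{N}}}}\ge\beta_{\mathrm{LB}}^{\mathcal{N}},$$ and $u_K(\mu)\in X_K$ is the unique solution of $a^{\mathcal{N}}(u_K(\mu),v;\mu)=f^{\mathcal{N}}(v;\mu)$ for all $v\in Y_K$. *)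

(* Defs.v *)
From HB Require Import structures.
From mathcomp Require Import all_boot all_order all_algebra complex.
From mathcomp Require Import all_classical all_reals all_analysis.

Set Implicit Arguments.
Unset Strict Implicit.
Unset Printing Implicit Defensive.

Import Order.TTheory GRing.Theory Num.Theory.
Import numFieldNormedType.Exports.

Local Open Scope classical_set_scope.
Local Open Scope ring_scope.
Local Open Scope complex_scope.

Inductive scalar_kind := RealScalars | ComplexScalars.

Definition scalar_field (R : realType) (k : scalar_kind) : numFieldType :=
  match k with
  | RealScalars => R
  | ComplexScalars => R[i]
  end.

Definition scalar_conj (R : realType) (k : scalar_kind) :
    scalar_field R k -> scalar_field R k :=
  match k with
  | RealScalars => fun x : R => x
  | ComplexScalars => fun x : R[i] => x^*
  end.

Definition scalar_re (R : realType) (k : scalar_kind) : scalar_field R k -> R :=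
  match k with
  | RealScalars => fun x : R => x
  | ComplexScalars => fun x : R[i] => complex.Re x
  end.

(* The norm of a normed space over R[i] takes its values in R[i], as real
   nonnegative elements; [rnorm] is that norm read in R.  It applies to the
   scalars themselves as well. *)
Definition rnorm (R : realType) (k : scalar_kind)
    (V : normedZmodType (scalar_field R k)) (v : V) : R :=
  scalar_re `|v|.

#[short(type="normedVectType")]
HB.structure Definition NormedVector (K : numFieldType) :=
  {T of Vector K T & NormedModule K T}.

(* A Hilbert space is a complete normed space together with an inner product
   inducing its norm. *)
Definition induces_norm (R : realType) (k : scalar_kind)
    (H : normedModType (scalar_field R k))
    (dot : {dot H for @scalar_conj R k}) : Prop :=
  forall x : H, dot x x = `|x| ^+ 2.

Section PetrovGalerkin.
Variables (R : realType) (k : scalar_kind).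
Let K := scalar_field R k.
Variables X Y : normedVectType K.
Implicit Types (V : {vspace X}) (W : {vspace Y}).

(* The inf and sup are taken in [\bar R], so that the infimum over an empty
   set (the case V = 0) is +oo. *)
Definition inf_sup (a : X -> Y -> K) V W : \bar R :=
  ereal_inf [set ereal_sup [set (rnorm (a w v) / (rnorm w * rnorm v))%:E
                           | v in [set v | v \in W /\ v != 0]]
            | w in [set w | w \in V /\ w != 0]].

Definition is_unique_solution (a : X -> Y -> K) (f : Y -> K) V W (u : X) : Prop :=
  unique (fun w => w \in V /\ forall v, v \in W -> a w v = f v) u.

End PetrovGalerkin.

(* Main.v *)
Require Import Defs.
From HB Require Import structures.
From mathcomp Require Import all_boot all_order all_algebra complex.
From mathcomp Require Import all_classical all_reals all_analysis.
From mathcomp Require Import lra.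

Set Implicit Arguments.
Unset Strict Implicit.
Unset Printing Implicit Defensive.

Import Order.TTheory GRing.Theory Num.Theory.
Import numFieldNormedType.Exports.

Local Open Scope classical_set_scope.
Local Open Scope ring_scope.

(** The reduced approximation [uM mu] stands in for the truth solution [u mu].
    By the triangle inequality the computable distance [Delta mu] between the
    two reduced solutions and the unknown error of [uN mu] differ by at most the
    error of [uM mu], and saturation bounds this difference by [Theta] times the
    error of [uN mu].  Solving the two resulting linear inequalities for that
    error gives the lower and the upper bound ([saturated_error_bounds]).

    The norm takes values in the scalar field, so the triangle inequality has to
    be carried over to the real-valued [rnorm] ([ler_rnorm_distD]); this works
    over both fields because [scalar_re] is additive and monotone. *)

Lemma scalar_reD (R : realType) (k : scalar_kind) (x y : scalar_field R k) :
  scalar_re (x + y) = scalar_re x + scalar_re y.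
Proof. by case: k x y => //= -[a b] [c d]. Qed.

(** In [R[i]], [x <= y] forces equal imaginary parts and compares the real
    parts. *)
Lemma ler_scalar_re (R : realType) (k : scalar_kind) (x y : scalar_field R k) :
  x <= y -> scalar_re x <= scalar_re y.
Proof.
case: k x y => //= -[a b] [c d] /=.
by rewrite lecE => /andP[].
Qed.

Lemma rnorm_distC (R : realType) (k : scalar_kind)
    (V : normedZmodType (scalar_field R k)) (v w : V) :
  rnorm (v - w) = rnorm (w - v).
Proof. by rewrite /rnorm distrC. Qed.

Lemma ler_rnorm_distD (R : realType) (k : scalar_kind)
    (V : normedZmodType (scalar_field R k)) (w v z : V) :
  rnorm (v - z) <= rnorm (v - w) + rnorm (w - z).
Proof. by rewrite /rnorm -scalar_reD; apply/ler_scalar_re/ler_distD. Qed.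

(** With e the error of [v] and d the distance from [w] to [v], passing through
    [x] gives d <= (1 + theta) e and passing through [w] gives
    e <= theta e + d. *)
Lemma saturated_error_bounds (R : realType) (k : scalar_kind)
    (V : normedZmodType (scalar_field R k)) (x v w : V) (theta : R) :
    0 < theta < 1 -> rnorm (x - w) <= theta * rnorm (x - v) ->
  rnorm (w - v) / (1 + theta) <= rnorm (x - v) <= rnorm (w - v) / (1 - theta).
Proof.
move=> /andP[theta_gt0 theta_lt1] sat.
have dist_le := ler_rnorm_distD x w v.
rewrite [rnorm (w - x)]rnorm_distC in dist_le.
have err_le := ler_rnorm_distD w x v.
rewrite ler_pdivrMr ?ler_pdivlMr ?subr_gt0 ?addr_gt0 //.
by apply/andP; split; lra.
Qed.

Theorem proposition3p1 (R : realType) (k : scalar_kind)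
  (* compact parameter space *)
  (p : nat) (P : set 'rV[R]_p) (P_compact : compact P)
  (* Hilbert spaces *)
  (X Y : completeNormedModType (scalar_field R k))
  (dotX : {dot X for @scalar_conj R k}) (dotX_norm : induces_norm dotX)
  (dotY : {dot Y for @scalar_conj R k}) (dotY_norm : induces_norm dotY)
  (* discrete trial and test spaces, embedded in X and Y *)
  (Xh Yh : normedVectType (scalar_field R k))
  (iX : {linear Xh -> X}) (iX_inj : injective iX)
  (iY : {linear Yh -> Y}) (iY_inj : injective iY)
  (Nh : nat) (dim_Xh : \dim {:Xh} = Nh) (dim_Yh : \dim {:Yh} = Nh)
  (* forms *)
  (a : 'rV[R]_p ->
       {bilinear Xh -> Yh -> scalar_field R k | *%R & @scalar_conj R k \; *%R})
  (f : 'rV[R]_p -> {linear Yh -> scalar_field R k | @scalar_conj R k \; *%R})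
  (a_cont : forall mu, P mu -> continuous (fun z : Xh * Yh => a mu z.1 z.2))
  (f_cont : forall mu, P mu -> continuous (f mu))
  (* inf-sup stability *)
  (beta : R) (beta_gt0 : 0 < beta)
  (inf_sup_h : forall mu, P mu -> (beta%:E <= inf_sup (a mu) {:Xh} {:Yh})%E)
  (* truth solution *)
  (u : 'rV[R]_p -> Xh)
  (u_sol : forall mu, P mu ->
    is_unique_solution (a mu) (f mu) {:Xh} {:Yh} (u mu))
  (* reduced trial spaces *)
  (N M : nat) (N_lt_M : (N < M)%N)
  (mus : N.-tuple 'rV[R]_p) (mus_in : forall i, P (tnth mus i))
  (XN XM : {vspace Xh}) (XN_span : XN = <<map u mus>>%VS)
  (dim_XN : \dim XN = N) (dim_XM : \dim XM = M)
  (XN_sub_XM : (XN <= XM)%VS) (XN_neq_XM : XN <> XM)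
  (* reduced test spaces *)
  (YN YM : {vspace Yh}) (dim_YN : \dim YN = N) (dim_YM : \dim YM = M)
  (inf_sup_N : forall mu, P mu -> (beta%:E <= inf_sup (a mu) XN YN)%E)
  (inf_sup_M : forall mu, P mu -> (beta%:E <= inf_sup (a mu) XM YM)%E)
  (* reduced basis approximations *)
  (uN uM : 'rV[R]_p -> Xh)
  (uN_sol : forall mu, P mu -> is_unique_solution (a mu) (f mu) XN YN (uN mu))
  (uM_sol : forall mu, P mu -> is_unique_solution (a mu) (f mu) XM YM (uM mu))
  (* saturation property *)
  (Theta : R) (Theta_gt0 : 0 < Theta) (Theta_lt1 : Theta < 1)
  (saturation : forall mu, P mu ->
    rnorm (u mu - uM mu) <= Theta * rnorm (u mu - uN mu)) :
  let Delta mu := rnorm (uM mu - uN mu) in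
  forall mu, P mu ->
    Delta mu / (1 + Theta) <= rnorm (u mu - uN mu) /\
    rnorm (u mu - uN mu) <= Delta mu / (1 - Theta).
Proof.
move=> Delta mu Pmu.
apply/andP/saturated_error_bounds; last exact: saturation.
by rewrite Theta_gt0.
Qed.
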